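(* Let $\theta_1,\theta_2,\theta_3\in[0,\pi]$, and let $\mathrm{C}(\theta_1),\mathrm{C}(\theta_2),\mathrm{C}(\theta_3)$ be the corresponding $\operatorname{SU}(2)$-conjugacy classes. Then there exist matrices $A_1,A_2,A_3\in\operatorname{SU}(2)$ satisfying (i) $A_i\in \mathrm{C}(\theta_i)$ for $i=1,2,3$; and (ii) $A_1\cdot A_2\cdot A_3=\begin{pmatrix}1&0\\0&1\end{pmatrix}$ if and only if the triple $(\theta_1,\theta_2,\theta_3)\in[0,\pi]^3$ lies in the tetrahedron $\Delta\subseteq\mathbb{R}^3$, inscribed in the cube $\{(\theta_1,\theta_2,\theta_3)\in\mathbb{R}^3 : 0\leq\theta_i\leq\pi \text{ for } i=1,2,3\}$, that is described by the following four inequalities: - $\theta_1-\theta_2\leq\theta_3$; - $-\theta_1+\theta_2\leq\theta_3$; - $\theta_3\leq\theta_1+\theta_2$; - $\theta_3\leq 2\pi-(\theta_1+\theta_2)$.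
   Context: $\operatorname{SU}(2)=\{A\in\mathbb{C}^{2\times 2} : AA^*=1,\ \det(A)=1\}$, where $A^*$ is the conjugate transpose of $A$. For $\theta\in[0,\pi]$, $\mathrm{C}(\theta)$ denotes the $\operatorname{SU}(2)$-conjugacy class of the diagonal matrix $$\begin{pmatrix}\cos(\theta)+\sqrt{-1}\,\sin(\theta)&0\\0&\cos(\theta)-\sqrt{-1}\,\sin(\theta)\end{pmatrix}.$$ Every $\operatorname{SU}(2)$-conjugacy class is of the form $\mathrm{C}(\theta)$ for exactly one $\theta\in[0,\pi]$. *)

(* Defs.v *)
From mathcomp Require Import all_boot all_order all_algebra.
From mathcomp Require Import all_classical all_reals all_analysis.
From mathcomp Require Import complex ring lra.

Set Implicit Arguments.
Unset Strict Implicit.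
Unset Printing Implicit Defensive.

Import Order.TTheory GRing.Theory Num.Theory.

Local Open Scope classical_set_scope.
Local Open Scope ring_scope.
Local Open Scope complex_scope.
Local Open Scope sesquilinear_scope.

Definition SU2 (R : realType) : set 'M[R[i]]_2 :=
  [set A | A *m A^t* = 1%:M /\ \det A = 1].

Definition SU2_class (R : realType) (D : 'M[R[i]]_2) : set 'M[R[i]]_2 :=
  [set U *m D *m invmx U | U in @SU2 R].

Definition diag_angle (R : realType) (theta : R) : 'M[R[i]]_2 :=
  diag_mx (\row_(j < 2) if j == 0 then cos theta +i* sin theta
                                  else cos theta -i* sin theta).

Definition Cl (R : realType) (theta : R) : set 'M[R[i]]_2 :=
  SU2_class (diag_angle theta).

Definition Delta (R : realType) : set (R * R * R) :=
  [set t : R * R * R | let: (theta1, theta2, theta3) := t in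
    [/\ theta1 - theta2 <= theta3,
        - theta1 + theta2 <= theta3,
        theta3 <= theta1 + theta2
      & theta3 <= 2 * pi - (theta1 + theta2)]].

(* [Delta] is the tetrahedron whose vertices are the four vertices (0,0,0),
   (pi,pi,0), (pi,0,pi), (0,pi,pi) of the cube [0,pi]^3, given here by their
   barycentric coordinates. *)
Lemma Delta_tetrahedron (R : realType) (x y z : R) :
  Delta (x, y, z) <->
  exists a b c d : R,
    [/\ [/\ 0 <= a, 0 <= b, 0 <= c & 0 <= d],
        a + b + c + d = 1
      & [/\ x = b * pi + c * pi, y = b * pi + d * pi & z = c * pi + d * pi]].
Proof.
rewrite /Delta /=; move: (pi : R) (pi_gt0 R) => p p0.
have pn0 : p != 0 by rewrite gt_eqF.
have ip0 : 0 <= (2 * p)^-1 by rewrite invr_ge0; lra.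
split=> [[/= h1 h2 h3 h4]|[a [b [c [d [[a0 b0 c0 d0] s1 [-> -> ->]]]]]]].
- exists ((2 * p - x - y - z) / (2 * p)), ((x + y - z) / (2 * p)),
    ((x + z - y) / (2 * p)), ((y + z - x) / (2 * p)).
  split; [by split; apply: mulr_ge0 => //; lra | by field | by split; field].
- have ea : a = 1 - b - c - d by lra.
  have a0' : 0 <= (1 - b - c - d) * p by rewrite -ea mulr_ge0 // ltW.
  have b0' : 0 <= b * p by rewrite mulr_ge0 // ltW.
  have c0' : 0 <= c * p by rewrite mulr_ge0 // ltW.
  have d0' : 0 <= d * p by rewrite mulr_ge0 // ltW.
  split=> /=; lra.
Qed.

(* Main.v *)
(* SU(2) is the group of unit quaternions, and the conjugacy class C(theta)
   consists of those with real part cos theta.  If A1, A2 have imaginary parts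
   v1, v2, of norms sin theta1, sin theta2, then A1 A2 has real part
     cos theta1 cos theta2 - <v1, v2>.
   By Cauchy-Schwarz this takes exactly the values between
   cos (theta1 + theta2) and cos (theta1 - theta2), so a solution exists iff
   cos theta3, the real part of A3^-1, lies between them; monotonicity of cos
   on [0, pi] turns this into the four linear inequalities. *)
Require Import Defs.
From mathcomp Require Import all_boot all_order all_algebra.
From mathcomp Require Import all_classical all_reals all_analysis.
From mathcomp Require Import complex ring lra.

Import Order.TTheory GRing.Theory Num.Theory.

Local Open Scope classical_set_scope.
Local Open Scope ring_scope.
Local Open Scope complex_scope.
Local Open Scope sesquilinear_scope.

Lemma ord2P (i : 'I_2) : i = 0 \/ i = 1.
Proof. by case: i => [[|[|//]]] h; [left|right]; apply: val_inj. Qed.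

Lemma matrix2P (T : Type) (A B : 'M[T]_2) :
  [/\ A 0 0 = B 0 0, A 0 1 = B 0 1, A 1 0 = B 1 0 & A 1 1 = B 1 1] -> A = B.
Proof.
move=> [e00 e01 e10 e11]; apply/matrixP=> i j.
by case: (ord2P i) => ->; case: (ord2P j) => ->.
Qed.

Lemma mulmx2E (K : pzRingType) (A B : 'M[K]_2) i j :
  (A *m B) i j = A i 0 * B 0 j + A i 1 * B 1 j.
Proof.
rewrite mxE !big_ord_recl big_ord0 addr0.
by congr (_ + A i _ * B _ j); apply: val_inj.
Qed.

Lemma det_mx2 (K : comPzRingType) (A : 'M[K]_2) :
  \det A = A 0 0 * A 1 1 - A 0 1 * A 1 0.
Proof.
rewrite (expand_det_row _ 0) !big_ord_recl big_ord0 addr0 /cofactor !det_mx11.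
rewrite !mxE /= expr0 mul1r expr1 mulN1r mulrN.
by congr (A _ _ * A _ _ - A _ _ * A _ _); apply: val_inj.
Qed.

(* The quaternion p + q i + r j + s k as a complex matrix. *)
Definition qmx {R : realType} (p q r s : R) : 'M[R[i]]_2 :=
  \matrix_(i, j) if i == 0 then (if j == 0 then p +i* q else r +i* s)
                 else (if j == 0 then - r +i* s else p -i* q).

Lemma qmx_inj (R : realType) (p q r s p' q' r' s' : R) :
  qmx p q r s = qmx p' q' r' s' -> [/\ p = p', q = q', r = r' & s = s'].
Proof.
move=> /matrixP e; move: (e 0 0) (e 0 1).
by rewrite !mxE /= => -[-> ->] [-> ->].
Qed.

Lemma qmx1 (R : realType) : qmx 1 0 0 0 = 1%:M :> 'M[R[i]]_2.
Proof. by apply: matrix2P; split; rewrite !mxE /= ?oppr0. Qed.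

Lemma qmxM (R : realType) (p q r s p' q' r' s' : R) :
  qmx p q r s *m qmx p' q' r' s' =
  qmx (p * p' - (q * q' + r * r' + s * s'))
      (p * q' + q * p' + (r * s' - s * r'))
      (p * r' + r * p' + (s * q' - q * s'))
      (p * s' + s * p' + (q * r' - r * q')).
Proof.
apply: matrix2P; rewrite !mulmx2E !mxE /=.
by split; apply/eqP; rewrite eq_complex /=; apply/andP; split; apply/eqP; ring.
Qed.

Lemma qmx_adj (R : realType) (p q r s : R) :
  (qmx p q r s)^t* = qmx p (- q) (- r) (- s).
Proof.
apply: matrix2P; split; rewrite !mxE;
  by apply/eqP; rewrite eq_complex /= ?opprK !eqxx.
Qed.

Lemma qmxV (R : realType) (p q r s : R) :
  p ^+ 2 + q ^+ 2 + r ^+ 2 + s ^+ 2 = 1 ->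
  qmx p q r s *m qmx p (- q) (- r) (- s) = 1%:M.
Proof.
move=> n1; rewrite qmxM -qmx1; congr (qmx _ _ _ _); rewrite -?n1; ring.
Qed.

(** The first row determines the second: orthogonality of the rows together with determinant 1
    forces [d = a^*] and [c = - b^*]. *)
Lemma SU2P (R : realType) (A : 'M[R[i]]_2) :
  SU2 A <-> exists p q r s,
    p ^+ 2 + q ^+ 2 + r ^+ 2 + s ^+ 2 = 1 /\ A = qmx p q r s.
Proof.
split=> [[/matrixP AA dA]|[p [q [r [s [n1 ->]]]]]]; last first.
  split; first by rewrite qmx_adj qmxV.
  rewrite det_mx2 !mxE /=; apply/eqP; rewrite eq_complex /=.
  by apply/andP; split; apply/eqP; rewrite -?n1; ring.
move: dA (AA 0 0) (AA 1 0) (AA 1 1); rewrite det_mx2 !mulmx2E !mxE /=.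
set a := A 0 0; set b := A 0 1; set c := A 1 0; set d := A 1 1.
move=> dA e00 e10 e11.
have ed : d = a^*.
  (* Insert the squared norm of the first row, which is 1, and regroup into the determinant and the
     inner product of the two rows. *)
  transitivity (d * (a * a^* + b * b^*)); first by rewrite e00 mulr1.
  rewrite [LHS](_ : _ = (a * d - b * c) * a^* + b * (c * a^* + d * b^*));
    last by ring.
  by rewrite e10 dA; ring.
have ec : c = - b^*.
  transitivity (c * (a * a^* + b * b^*)); first by rewrite e00 mulr1.
  rewrite [LHS](_ : _ = - (a * d - b * c) * b^* + a * (c * a^* + d * b^*));
    last by ring.
  by rewrite e10 dA; ring.
move: ed ec e00; rewrite /a /b /c /d => {a b c d dA e10 e11}.
case ea : (A 0 0) => [p q]; case eb : (A 0 1) => [r s] ed ec /eqP.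
rewrite eq_complex /= => /andP[/eqP e _].
exists p, q, r, s; split; first by rewrite -e; ring.
apply: matrix2P; split; rewrite ?ea ?eb ?ec ?ed !mxE;
  by apply/eqP; rewrite eq_complex /= ?opprK ?eqxx.
Qed.

Lemma diag_angleE (R : realType) (t : R) :
  diag_angle t = qmx (cos t) (sin t) 0 0.
Proof. by apply: matrix2P; split; rewrite !mxE /= ?oppr0. Qed.

Lemma mulmx1_invmx (K : comUnitRingType) n (A B : 'M[K]_n) :
  A *m B = 1%:M -> invmx A = B.
Proof.
move=> AB; have [uA _] := mulmx1_unit AB.
by rewrite -[LHS]mulmx1 -AB mulKmx.
Qed.

(** Conjugation by a unit quaternion fixes the real part and rotates the imaginary part, so its
    length is preserved. *)
Lemma Cl_qmx (R : realType) (t : R) (A : 'M[R[i]]_2) :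
  Cl t A -> exists q r s,
    q ^+ 2 + r ^+ 2 + s ^+ 2 = sin t ^+ 2 /\ A = qmx (cos t) q r s.
Proof.
move=> [U /SU2P[p [q [r [s [n1 ->]]]]] <-].
rewrite (mulmx1_invmx _ _ _ _ (qmxV _ _ _ _ _ n1)) diag_angleE !qmxM.
set c := cos t; set u := sin t.
(* This is [u] times the first column of the Euler-Rodrigues rotation matrix, the image of the
   vector [(u, 0, 0)]. *)
exists (u * (p ^+ 2 + q ^+ 2 - r ^+ 2 - s ^+ 2)),
  (2 * u * (p * s + q * r)), (2 * u * (q * s - p * r)); split.
  by rewrite -[RHS]mulr1 -[in RHS](expr1n R 2) -[in RHS]n1; ring.
congr (qmx _ _ _ _); try ring.
by rewrite -[c in RHS]mulr1 -[in RHS]n1; ring.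
Qed.

Lemma Cl_SU2 (R : realType) (t : R) (A : 'M[R[i]]_2) : Cl t A -> SU2 A.
Proof.
move=> /Cl_qmx[q [r [s [e ->]]]]; apply/SU2P; exists (cos t), q, r, s.
by split=> //; rewrite -(cos2Dsin2 t) -e; ring.
Qed.

(* If n is a unit imaginary quaternion with n != - i, then u = n + i
   satisfies u i = n u, so u conjugates i to n; for n = - i take u = j. *)
Lemma qmx_Cl (R : realType) (t q r s : R) :
  q ^+ 2 + r ^+ 2 + s ^+ 2 = sin t ^+ 2 -> Cl t (qmx (cos t) q r s).
Proof.
move=> nq.
suff [a [b [c [d [n1 e]]]]] : exists a b c d : R,
    a ^+ 2 + b ^+ 2 + c ^+ 2 + d ^+ 2 = 1 /\
    qmx a b c d *m qmx (cos t) (sin t) 0 0 = qmx (cos t) q r s *m qmx a b c d.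
  exists (qmx a b c d); first by apply/SU2P; exists a, b, c, d.
  rewrite diag_angleE (mulmx1_invmx _ _ _ _ (qmxV _ _ _ _ _ n1)) e.
  by rewrite -mulmxA (qmxV _ _ _ _ _ n1) mulmx1.
set u := sin t in nq *; set c := cos t.
(* Working with the unnormalised imaginary part avoids dividing by [u]; the case [u = 0] forces
   [q = 0] and falls into the first branch. *)
have [eq|nqu] := eqVneq (q + u) 0.
  have eqq : q = - u by lra.
  have [r0 s0] : r = 0 /\ s = 0.
    have : r ^+ 2 + s ^+ 2 = 0 by move: nq; rewrite eqq; lra.
    by move/eqP; rewrite paddr_eq0 ?sqr_ge0// !sqrf_eq0 => /andP[/eqP-> /eqP->].
  exists 0, 0, 1, 0; split; first by ring.
  by rewrite !qmxM eqq r0 s0; congr (qmx _ _ _ _); ring.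
set N := (q + u) ^+ 2 + r ^+ 2 + s ^+ 2.
have N0 : 0 < N.
  have : 0 < (q + u) ^+ 2 by rewrite exprn_even_gt0.
  rewrite /N; have := sqr_ge0 r; have := sqr_ge0 s; lra.
set w := (Num.sqrt N)^-1.
have w2 : w ^+ 2 * N = 1 by rewrite /w exprVn sqr_sqrtr ?ltW// mulVf ?gt_eqF.
exists 0, (w * (q + u)), (w * r), (w * s); split; first by rewrite -w2 /N; ring.
rewrite !qmxM; congr (qmx _ _ _ _); try ring.
(* Only the real parts remain; their equality is where the length condition [nq] enters. *)
apply/eqP; rewrite -subr_eq0; apply/eqP.
rewrite [LHS](_ : _ = w * (q ^+ 2 + r ^+ 2 + s ^+ 2 - u ^+ 2)); last by ring.
by rewrite nq subrr mulr0.
Qed.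

(** Since cos decreases on [0, pi], each angle is first folded into that interval: [x - y] to its
    absolute value, and [x + y] to [2 * pi - (x + y)] when it exceeds pi. In either case for
    [x + y], the other upper bound on [z] is automatic. *)
Lemma Delta_cos (R : realType) (x y z : R) :
  0 <= x <= pi -> 0 <= y <= pi -> 0 <= z <= pi ->
  Delta (x, y, z) <-> cos (x + y) <= cos z <= cos (x - y).
Proof.
move=> /andP[x0 xp] /andP[y0 yp] /andP[z0 zp].
have cle (a b : R) : 0 <= a <= pi -> 0 <= b <= pi ->
    (cos a <= cos b) = (b <= a).
  by move=> ha hb; rewrite !leNgt ltr_cos ?in_itv.
have -> : (cos z <= cos (x - y)) = (`|x - y| <= z).
  rewrite -(cos_norm (x - y)) cle ?z0 ?normr_ge0//= ler_norml; lra.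
have -> : (cos (x + y) <= cos z) = (z <= x + y) && (z <= 2 * pi - (x + y)).
  have [h|h] := leP (x + y) pi.
    rewrite cle; [|lra..].
    by apply/idP/andP => [?|[? ?]]; [split|]; lra.
  rewrite -cosN -(cosD2pi (- _)) cle; [|lra..].
  by apply/idP/andP => [?|[? ?]]; [split|]; lra.
rewrite ler_norml /Delta /=; split=> [[? ? ? ?]|/andP[/andP[? ?] /andP[? ?]]].
  by apply/andP; split; apply/andP; split; lra.
by split; lra.
Qed.

Theorem theorem1p3 (R : realType) (theta1 theta2 theta3 : R)
    (h1 : 0 <= theta1 <= pi) (h2 : 0 <= theta2 <= pi)
    (h3 : 0 <= theta3 <= pi) :
  (exists A1 A2 A3 : 'M[R[i]]_2,
      [/\ SU2 A1, SU2 A2 & SU2 A3] /\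
      [/\ Cl theta1 A1, Cl theta2 A2 & Cl theta3 A3] /\
      A1 *m A2 *m A3 = 1%:M)
  <-> Delta (theta1, theta2, theta3).
Proof.
rewrite Delta_cos// cosD cosB.
have n1 := cos2Dsin2 theta1; have n2 := cos2Dsin2 theta2.
have n3 := cos2Dsin2 theta3.
have s1 := sin_ge0_pi h1; have s2 := sin_ge0_pi h2.
split=> [[A1 [A2 [A3 [_ [[]]]]]]|].
  move=> /Cl_qmx[q [r [s [e ->]]]] /Cl_qmx[q' [r' [s' [e' ->]]]].
  move=> /Cl_qmx[q'' [r'' [s'' [e'' ->]]]] A123.
  have n'' : cos theta3 ^+ 2 + q'' ^+ 2 + r'' ^+ 2 + s'' ^+ 2 = 1.
    by rewrite -n3 -e''; ring.
  (* Multiplying by the inverse of A3 gives A1 A2 = A3^-1; comparing real parts expresses cos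
     theta3. *)
  have := congr1 (mulmx^~ (qmx (cos theta3) (- q'') (- r'') (- s''))) A123.
  rewrite -mulmxA qmxV// mulmx1 mul1mx qmxM => /qmx_inj[<- _ _ _].
  suff : `|q * q' + r * r' + s * s'| <= sin theta1 * sin theta2.
    by rewrite ler_norml; lra.
  rewrite -(@ler_sqr R) ?nnegrE ?mulr_ge0// real_normK ?num_real//.
  rewrite exprMn -e -e' -subr_ge0.
  (* Lagrange's identity *)
  rewrite [leRHS](_ : _ = (q * r' - r * q') ^+ 2 + (q * s' - s * q') ^+ 2 +
                       (r * s' - s * r') ^+ 2); last by ring.
  by rewrite !addr_ge0 ?sqr_ge0.
move=> /andP[lo hi].
set c1 := cos theta1 in n1 lo hi *; set c2 := cos theta2 in n2 lo hi *.
set c3 := cos theta3 in n3 lo hi *; set u1 := sin theta1 in n1 s1 lo hi *.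
set u2 := sin theta2 in n2 s2 lo hi *.
(* [x] is to be the cosine of the angle between the axes of A1 and A2. If [u1 * u2 = 0], then [lo]
   and [hi] already force [c3 = c1 * c2]. *)
have [x [x1 ex]] : exists x : R, x ^+ 2 <= 1 /\ c3 = c1 * c2 - u1 * u2 * x.
  have [u0|u0] := eqVneq (u1 * u2) 0.
    by exists 0; rewrite expr0n ler01; split=> //; lra.
  have up : 0 < u1 * u2 by rewrite lt_neqAle eq_sym u0 mulr_ge0.
  exists ((c1 * c2 - c3) / (u1 * u2)); split; last first.
    by rewrite [u1 * u2 * _]mulrC divfK//; lra.
  rewrite exprMn exprVn ler_pdivrMr ?exprn_gt0// mul1r.
  (* The difference of squares factors into the two gaps that [lo] and [hi] make nonnegative. *)
  rewrite -subr_ge0 subr_sqr mulr_ge0//; lra.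
set y := Num.sqrt (1 - x ^+ 2).
have y2 : y ^+ 2 = 1 - x ^+ 2 by rewrite sqr_sqrtr ?subr_ge0.
(* With axis i for A1 and x i + y j for A2, these are the imaginary coordinates of A1 A2; A3 is then
   the conjugate of this product. *)
pose a := c1 * (u2 * x) + u1 * c2; pose b := c1 * (u2 * y).
pose d := u1 * (u2 * y).
have C1 : Cl theta1 (qmx c1 u1 0 0) by apply: qmx_Cl; rewrite -/u1; ring.
have C2 : Cl theta2 (qmx c2 (u2 * x) (u2 * y) 0).
  by apply: qmx_Cl; rewrite !exprMn y2 -/u2; ring.
have abd : a ^+ 2 + b ^+ 2 + d ^+ 2 = sin theta3 ^+ 2.
  have -> : sin theta3 ^+ 2 = 1 - c3 ^+ 2 by rewrite -n3; ring.
  (* Multiplicativity of the quaternion norm: 1 is written as the product of the squared norms of A1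
     and A2. *)
  rewrite -[in RHS](mulr1 1) -{1}n1 -n2 ex /a /b /d !exprMn y2; ring.
have C3 : Cl theta3 (qmx c3 (- a) (- b) (- d)).
  by apply: qmx_Cl; rewrite !sqrrN.
have e12 : qmx c1 u1 0 0 *m qmx c2 (u2 * x) (u2 * y) 0 = qmx c3 a b d.
  by rewrite qmxM; congr (qmx _ _ _ _); rewrite ?ex /a /b /d; ring.
exists (qmx c1 u1 0 0), (qmx c2 (u2 * x) (u2 * y) 0),
  (qmx c3 (- a) (- b) (- d)); split; [|split=> //].
  split; apply: Cl_SU2; eassumption.
by rewrite e12 qmxV// -n3 -abd; ring.
Qed.
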